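(* If $Z\leq_T 0'$ is almost everywhere dominating, then $Z'\equiv_{tt}0''$, and hence $Z$ is super-high.
   Context: $\leq_{tt}$ denotes truth-table reducibility and $\equiv_{tt}$ the induced equivalence. A set $A$ is super-high if $A'\geq_{tt}0''$. $\mu$ is the fair-coin (Lebesgue) probability measure on $2^\omega$; ''almost all'' means on a set of $\mu$-measure $1$. For $f,g\in\omega^\omega$, $f$ dominates $g$ if $\exists m\,\forall n>m\,(f(n)>g(n))$. A set $A\in 2^\omega$ is almost everywhere (a.e.) dominating if for almost all $X\in 2^\omega$ and all functions $g\leq_T X$, there is a function $f\leq_T A$ such that $f$ dominates $g$. *)

(* Defs.v *)
From Stdlib Require Cantor.
From HB Require Import structures.
From mathcomp Require Import all_boot all_order all_algebra.
From mathcomp Require Import all_classical all_reals all_analysis.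

Set Implicit Arguments.
Unset Strict Implicit.
Unset Printing Implicit Defensive.

Import Order.TTheory GRing.Theory Num.Theory.

Local Open Scope classical_set_scope.

(* A subset of omega, i.e. a point of 2^omega, is its characteristic function
   nat -> bool; booleans coerce to the numbers 0 and 1. *)

Definition cpair (x y : nat) : nat := Cantor.to_nat (x, y).
Definition cfst (z : nat) : nat := (Cantor.of_nat z).1.
Definition csnd (z : nat) : nat := (Cantor.of_nat z).2.

(* Programs for the partial recursive functions relative to an oracle.
   They are unary, several arguments being passed through cpair. *)
Inductive program : Type :=
| PZero
| PSucc
| PFst
| PSnd
| POracle
| PPair of program & program
| PComp of program & program
| PRec of program & program
| PMu of program.

(* eval X p x y: the program p with oracle X halts on input x with output y. *)
Fixpoint eval (X : nat -> bool) (p : program) (x y : nat) {struct p} : Prop :=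
  match p with
  | PZero => y = 0
  | PSucc => y = x.+1
  | PFst => y = cfst x
  | PSnd => y = csnd x
  | POracle => y = X x
  | PPair p q => exists u v, [/\ eval X p x u, eval X q x v & y = cpair u v]
  | PComp p q => exists2 u, eval X q x u & eval X p u y
  | PRec p q =>
      (* on input <a, n>: s 0 = p(a), s (i+1) = q(<a, <i, s i>>), output s n *)
      exists s : nat -> nat,
        [/\ eval X p (cfst x) (s 0),
            forall i, i < csnd x ->
              eval X q (cpair (cfst x) (cpair i (s i))) (s i.+1)
          & y = s (csnd x)]
  | PMu p =>
      (* on input a: the least y with p(<a, y>) = 0, all earlier values of p
         being defined and nonzero *)
      eval X p (cpair x y) 0 /\
      forall k, k < y -> exists v, eval X p (cpair x k) v.+1
  end.

Lemma eval_functional X p x y z : eval X p x y -> eval X p x z -> y = z.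
Proof.
elim: p x y z => [||||| p IHp q IHq | p IHp q IHq | p IHp q IHq | p IHp] x y z
  /=; try by move=> -> ->.
- move=> [u [v [pu qv ->]]] [u' [v' [pu' qv' ->]]].
  by rewrite (IHp _ _ _ pu pu') (IHq _ _ _ qv qv').
- by move=> [u qu pu] [v qv]; rewrite -(IHq _ _ _ qu qv); exact: IHp.
- move=> [s [s0 sS ->]] [t [t0 tS ->]].
  suff h i : i <= csnd x -> s i = t i by exact: h.
  elim: i => [_|i IHi ix]; first exact: IHp s0 t0.
  apply: IHq (sS _ ix) _; rewrite (IHi (ltnW ix)); exact: tS.
- move=> [py ly] [pz lz]; case: (ltngtP y z) => // [yz|zy].
  + by have [v /(IHp _ _ _ py)] := lz _ yz.
  + by have [v /(IHp _ _ _ pz)] := ly _ zy.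
Qed.

(* Goedel numbering; numbers that encode no program are treated as indices of
   the nowhere defined function. *)
Fixpoint encode (p : program) : nat :=
  match p with
  | PZero => cpair 0 0
  | PSucc => cpair 1 0
  | PFst => cpair 2 0
  | PSnd => cpair 3 0
  | POracle => cpair 4 0
  | PPair p q => cpair 5 (cpair (encode p) (encode q))
  | PComp p q => cpair 6 (cpair (encode p) (encode q))
  | PRec p q => cpair 7 (cpair (encode p) (encode q))
  | PMu p => cpair 8 (encode p)
  end.

Lemma cpair_inj x y x' y' : cpair x y = cpair x' y' -> x = x' /\ y = y'.
Proof. by move=> /Cantor.to_nat_inj[-> ->]. Qed.

Lemma encode_inj : injective encode.
Proof.
by elim=> [||||| p IHp q IHq | p IHp q IHq | p IHp q IHq | p IHp]
  [||||| p' q' | p' q' | p' q' | p'] // /cpair_inj[// _];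
  do ?[move=> /cpair_inj[/IHp -> /IHq ->] | move=> /IHp ->].
Qed.

Definition phi (X : nat -> bool) (e x y : nat) : Prop :=
  exists2 p, encode p = e & eval X p x y.

Definition fun_turing_le (g : nat -> nat) (X : nat -> bool) : Prop :=
  exists p, forall n, eval X p n (g n).

Definition turing_le (A B : nat -> bool) : Prop :=
  fun_turing_le (fun n => A n : nat) B.

Definition emptyset : nat -> bool := fun=> false.

Definition computable (f : nat -> nat) : Prop := fun_turing_le f emptyset.

Definition jump (A : nat -> bool) : nat -> bool :=
  fun e => `[< exists y, phi A e e y >].

(* A truth-table condition is a propositional formula with atoms "m \in B". *)
Inductive ttform : Type :=
| TTAtom of nat
| TTNot of ttform
| TTAnd of ttform & ttform
| TTOr of ttform & ttform.

Fixpoint tt_sat (B : nat -> bool) (t : ttform) : bool :=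
  match t with
  | TTAtom m => B m
  | TTNot t => ~~ tt_sat B t
  | TTAnd t u => tt_sat B t && tt_sat B u
  | TTOr t u => tt_sat B t || tt_sat B u
  end.

Fixpoint tt_encode (t : ttform) : nat :=
  match t with
  | TTAtom m => cpair 0 m
  | TTNot t => cpair 1 (tt_encode t)
  | TTAnd t u => cpair 2 (cpair (tt_encode t) (tt_encode u))
  | TTOr t u => cpair 3 (cpair (tt_encode t) (tt_encode u))
  end.

Lemma tt_encode_inj : injective tt_encode.
Proof.
by elim=> [m | t IHt | t IHt u IHu | t IHt u IHu] [m' | t' | t' u' | t' u']
  // /cpair_inj[// _];
  do ?[move=> -> | move=> /cpair_inj[/IHt -> /IHu ->] | move=> /IHt ->].
Qed.

Definition tt_le (A B : nat -> bool) : Prop :=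
  exists t : nat -> ttform,
    computable (fun n => tt_encode (t n)) /\ forall n, A n = tt_sat B (t n).

Definition tt_equiv (A B : nat -> bool) : Prop := tt_le A B /\ tt_le B A.

Definition superhigh (A : nat -> bool) : Prop :=
  tt_le (jump (jump emptyset)) (jump A).

Definition dominates (f g : nat -> nat) : Prop :=
  exists m, forall n, m < n -> g n < f n.

(* 2^omega with its product sigma-algebra, generated by the coordinates. *)
Definition coordinate_sets : set (set (nat -> bool)) :=
  [set A | exists n, A = [set X | X n = true]].

Definition cantor : measurableType coordinate_sets.-sigma :=
  g_sigma_algebraType coordinate_sets.

(* The fair-coin measure is the law of the binary digits of a uniformly
   distributed element of [0, 1]; see coin_cylinder below. *)
Section coin.
Local Open Scope ring_scope.
Context (R : realType).

Definition digits (x : measurableTypeR R) : cantor :=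
  fun n => odd (Num.truncn ((x : R) * 2 ^+ n.+1)).

Lemma measurable_digits : measurable_fun [set: measurableTypeR R] digits.
Proof.
apply: (measurability (rT := cantor)) => //.
move=> _ [_ [n ->] <-]; rewrite setTI.
have -> : digits @^-1` [set X | X n = true] =
    \bigcup_(k in [set k : nat | odd k])
      `[k%:R / 2 ^+ n.+1, k.+1%:R / 2 ^+ n.+1[%classic.
  apply/seteqP; split=> [x /= ox|x [k /= ok]].
    exists (Num.truncn ((x : R) * 2 ^+ n.+1)) => //=.
    rewrite in_itv/= ler_pdivrMr ?ltr_pdivlMr ?exprn_gt0//.
    apply: truncn_itv; rewrite leNgt; apply/negP => x0.
    by move: ox; rewrite /digits truncn_floor leNgt x0.
  rewrite in_itv/= ler_pdivrMr ?ltr_pdivlMr ?exprn_gt0// => kx.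
  by rewrite /digits (truncn_def kx).
by apply: bigcup_measurable => k _; exact: measurable_itv.
Qed.

HB.instance Definition _ :=
  isMeasurableFun.Build _ _ _ _ digits measurable_digits.

Definition coin : probability cantor R :=
  distribution (uniform_prob (@ltr01 R)) digits.

Let trunc2 (n : nat) (x : R) : 0 <= x ->
  Num.truncn (x * 2 ^+ n.+1) =
  (odd (Num.truncn (x * 2 ^+ n.+1)) + (Num.truncn (x * 2 ^+ n)).*2)%N.
Proof.
move=> x0; have y0 m : 0 <= x * 2 ^+ m by rewrite mulr_ge0// exprn_ge0.
rewrite -[LHS]odd_double_half; congr (_ + _.*2)%N; apply/esym/truncn_def.
have /andP[] := truncn_itv (y0 n.+1).
set k := Num.truncn _; rewrite exprSr mulrA => h1 h2; apply/andP; split.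
  have : (k./2.*2 <= k)%N by rewrite -[leqRHS]odd_double_half leq_addl.
  rewrite -(ler_nat R) -muln2 natrM => h3.
  by have := le_trans h3 h1; rewrite ler_pM2r.
have : (k.+1 <= k./2.+1.*2)%N.
  by rewrite doubleS -{1}(odd_double_half k) -add1n addnA; case: (odd k).
rewrite -(ler_nat R) -muln2 natrM => h3.
by have := lt_le_trans h2 h3; rewrite ltr_pM2r.
Qed.

Let prefix_num (s : nat -> bool) (n : nat) : nat :=
  iteri n (fun i k => (s i + k.*2)%N) 0%N.

Let prefix_numP s n (x : R) : 0 <= x < 1 ->
  (forall i, (i < n)%N -> digits x i = s i) <->
  Num.truncn (x * 2 ^+ n) = prefix_num s n.
Proof.
move=> /andP[x0 x1]; elim: n => [|n [IH1 IH2]].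
  by split=> // _; rewrite expr0 mulr1; apply: truncn_def; rewrite x0.
rewrite /prefix_num/= -/(prefix_num s n) trunc2//; split=> [h|h].
  by rewrite -(h n (ltnSn n)) IH1// => i ni; exact/h/ltnW.
have o : digits x n = s n.
  by have := congr1 odd h; rewrite !oddD !odd_double !addbF !oddb.
move: h; rewrite -/(digits x n) o => /addnI/double_inj h.
by move=> i; rewrite ltnS leq_eqVlt => /predU1P[->//|]; exact: IH2.
Qed.

Let prefix_num_lt s n : (prefix_num s n < 2 ^ n)%N.
Proof.
elim: n => // n IH; rewrite /prefix_num/= -/(prefix_num s n) expnS mul2n.
by rewrite -leq_double in IH; apply: leq_trans IH; rewrite doubleS; case: (s n).
Qed.

Lemma coin_cylinder (s : nat -> bool) (n : nat) :
  coin [set X : nat -> bool | forall i, (i < n)%N -> X i = s i] =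
  (2^-1 ^+ n)%:E.
Proof.
set C := [set X | _]; pose D := digits @^-1` C; pose k := prefix_num s n.
pose I : set R := `[k%:R / 2 ^+ n, k.+1%:R / 2 ^+ n[%classic.
have p0 : 0 < 2 ^+ n :> R by rewrite exprn_gt0.
have inI x : 0 <= x < 1 -> D x <-> I x.
  move=> x01; rewrite /D /C /= prefix_numP// -/k.
  rewrite /I/= in_itv/= ler_pdivrMr// ltr_pdivlMr// -truncn_eq.
    by split=> /eqP.
  by rewrite mulr_ge0 ?(ltW p0)//; case/andP: x01.
have I01 x : I x -> 0 <= x < 1.
  rewrite /I/= in_itv/= => /andP[h1 h2].
  rewrite (le_trans _ h1) ?divr_ge0 ?(ltW p0)//=.
  rewrite (lt_le_trans h2)// ler_pdivrMr// mul1r -natrX ler_nat.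
  exact: prefix_num_lt.
have mI : measurable (I : set (measurableTypeR R)) by exact: measurable_itv.
have lI : lebesgue_measure I = (2^-1 ^+ n)%:E.
  rewrite /I lebesgue_measure_itv/= lte_fin ltr_pM2r ?invr_gt0// ltr_nat ltnSn.
  by rewrite -EFinD -mulrBl -natrB// subSnn mul1r exprVn.
pose E : set R := if `[< D 1 >] then [set 1] else set0.
have DE : D `&` `[0, 1]%classic = I `|` E.
  rewrite /E; case: asboolP => D1; apply/seteqP; split=> x /=.
  - move=> [Dx]; rewrite in_itv/= => /andP[x0]; rewrite le_eqVlt.
    by case/predU1P=> [|x1]; [right|left; apply/inI; rewrite ?x0].
  - move=> [Ix|->]; last by rewrite in_itv/= ler01 lexx.
    have x01 := I01 _ Ix; split; first exact/inI.
    by rewrite in_itv/=; case/andP: x01 => -> /ltW.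
  - move=> [Dx]; rewrite in_itv/= => /andP[x0]; rewrite le_eqVlt.
    case/predU1P=> [x1|x1]; first by rewrite -x1 in D1.
    by left; apply/inI; rewrite ?x0.
  - move=> [Ix|//]; have x01 := I01 _ Ix; split; first exact/inI.
    by rewrite in_itv/=; case/andP: x01 => -> /ltW.
have mE : measurable (E : set (measurableTypeR R)).
  by rewrite /E; case: ifP => _; [exact: measurable_set1|exact: measurable0].
have lE : lebesgue_measure E = 0%E.
  by rewrite /E; case: ifP => _; [exact: lebesgue_measure_set1|exact: measure0].
rewrite /coin/= /distribution /pushforward -/D /uniform_prob.
rewrite integral_uniform_pdf (eq_integral (cst 1%E)); last first.
  move=> x; rewrite inE => -[_ /=]; rewrite in_itv/= /uniform_pdf => ->.
  by rewrite subr0 invr1.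
by rewrite DE integral_cst ?mul1e ?measureU0//; exact: measurableU.
Qed.

End coin.

(* "For almost all X" is truth mu-almost everywhere for the fair-coin measure
   mu, taken with values in an arbitrary model R of the real numbers. *)
Definition ae_dominating (R : realType) (A : nat -> bool) : Prop :=
  \forall X \ae coin R,
    forall g : nat -> nat, fun_turing_le g X ->
      exists2 f : nat -> nat, fun_turing_le f A & dominates f g.

(* Main.v *)
From Stdlib Require Cantor.
From HB Require Import structures.
From mathcomp Require Import all_boot all_order all_algebra.
From mathcomp Require Import all_classical all_reals all_analysis.
From mathcomp Require Import zify ring lra.
Require Import Defs.
From mathcomp Require Import reals.

(* Membership in 0'' is written in the form "some u is correct for e", where
   correctness is Pi_1 and each e has at most one correct u.  To w = (e, u)
   is attached an event of probability 2^-(e+2) about its own block of coin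
   tosses.  With probability at least 1/2 no event of a correct w occurs, and
   then every w whose event occurs has a refutation, so the coin tosses compute
   a bound on these refutations.  By domination some f <=_T Z bounds the
   refutations for a set P of positive measure of coin tosses.  Let W be the
   Z-computable set of those w that are not refuted by stage f(w): it contains
   all correct w, and P avoids all its events.  By independence of the events
   the e-th section of W has at most c 2^(e+2) elements, so e is in 0'' iff for
   some k <= c 2^(e+2) this section has k elements but not k refuted ones; that
   is a truth-table condition on Z'. *)

Set Implicit Arguments.
Unset Strict Implicit.
Unset Printing Implicit Defensive.

(** * Functions computable with an oracle *)

Lemma cfst_pair x y : cfst (cpair x y) = x.
Proof. by rewrite /cfst Cantor.cancel_of_to. Qed.

Lemma csnd_pair x y : csnd (cpair x y) = y.
Proof. by rewrite /csnd Cantor.cancel_of_to. Qed.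

Definition cpairE := (cfst_pair, csnd_pair).

Lemma cpair_eta z : cpair (cfst z) (csnd z) = z.
Proof.
by rewrite /cpair /cfst /csnd -surjective_pairing Cantor.cancel_to_of.
Qed.

(* Several oracles are treated at once, so that one program serves them all. *)
Definition computes (I : Type) (O : I -> nat -> bool) (F : I -> nat -> nat) :=
  exists p, forall i n, eval (O i) p n (F i n).

Section Computes.
Context (I : Type) (O : I -> nat -> bool).
Implicit Types (F G H : I -> nat -> nat) (a b : I -> nat -> bool).
Local Notation computes := (computes O).

Lemma computes_ext F G : (forall i n, F i n = G i n) ->
  computes F -> computes G.
Proof. by move=> e [p hp]; exists p => i n; rewrite -e. Qed.

Lemma computes_comp F G : computes F -> computes G ->
  computes (fun i n => F i (G i n)).
Proof. by move=> [p hp] [q hq]; exists (PComp p q) => i n; exists (G i n). Qed.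

Lemma computes_succ F : computes F -> computes (fun i n => (F i n).+1).
Proof. by move=> [p hp]; exists (PComp PSucc p) => i n; exists (F i n). Qed.

Lemma computes_fst F : computes F -> computes (fun i n => cfst (F i n)).
Proof. by move=> [p hp]; exists (PComp PFst p) => i n; exists (F i n). Qed.

Lemma computes_snd F : computes F -> computes (fun i n => csnd (F i n)).
Proof. by move=> [p hp]; exists (PComp PSnd p) => i n; exists (F i n). Qed.

Lemma computes_oracle F : computes F -> computes (fun i n => O i (F i n)).
Proof. by move=> [p hp]; exists (PComp POracle p) => i n; exists (F i n). Qed.

Lemma computes_pair F G : computes F -> computes G ->
  computes (fun i n => cpair (F i n) (G i n)).
Proof.
by move=> [p hp] [q hq]; exists (PPair p q) => i n; exists (F i n), (G i n).
Qed.

Lemma computes_id : computes (fun=> id).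
Proof.
exists (PPair PFst PSnd) => i n.
by exists (cfst n), (csnd n); rewrite cpair_eta.
Qed.

Local Ltac projections :=
  repeat first [exact: computes_id | apply: computes_fst | apply: computes_snd].

Lemma computes_const c : computes (fun _ _ => c).
Proof. by elim: c => [|c /computes_succ//]; exists PZero. Qed.

(** [PRec] runs on a pair of a parameter and a length. The whole input is taken as the parameter, so
    that base, step and length may all depend on it. *)
Lemma computes_rec F N (G : I -> nat -> nat -> nat -> nat) :
  computes F -> computes N ->
  computes (fun i w => G i (cfst w) (cfst (csnd w)) (csnd (csnd w))) ->
  computes (fun i n => iteri (N i n) (G i n) (F i n)).
Proof.
move=> hF hN [r hr].
pose s i x k := iteri k (G i x) (F i x).
suff [q hq] : computes (fun i w => s i (cfst w) (csnd w)).
  have [p hp] := computes_pair computes_id hN.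
  exists (PComp q p) => i n; eexists; first exact: hp.
  by have := hq i (cpair n (N i n)); rewrite !cpairE.
have [p hp] := hF; exists (PRec p r) => i w; exists (s i (cfst w)).
split=> // k _ /=.
by have := hr i (cpair (cfst w) (cpair k (s i (cfst w) k))); rewrite !cpairE.
Qed.

(** A conditional is a recursion of length [b i n], that is 0 or 1, with base [G] and a step that
    discards its argument and returns [F]. *)
Lemma computes_if b F G : computes b -> computes F -> computes G ->
  computes (fun i n => if b i n then F i n else G i n).
Proof.
move=> hb hF hG.
have hF' : computes (fun i w => F i (cfst w)).
  by apply: computes_comp => //; projections.
have := @computes_rec _ _ (fun i n _ _ => F i n) hG hb hF'.
by apply: computes_ext => i n; case: (b i n).
Qed.

Lemma computes_pred F : computes F -> computes (fun i n => (F i n).-1).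
Proof.
have hG : computes (fun _ w => cfst (csnd w)) by projections.
move=> hF.
have := @computes_rec _ _ (fun _ _ k _ => k) (computes_const 0) hF hG.
by apply: computes_ext => i n; case: (F i n).
Qed.

Lemma computes_add F G : computes F -> computes G ->
  computes (fun i n => F i n + G i n).
Proof.
have h : computes (fun _ w => (csnd (csnd w)).+1).
  by apply: computes_succ; projections.
move=> hF hG; have := @computes_rec _ _ (fun _ _ _ s => s.+1) hF hG h.
apply: computes_ext => i n.
by elim: (G i n) => [|k /= ->]; rewrite ?addn0 ?addnS.
Qed.

Lemma computes_sub F G : computes F -> computes G ->
  computes (fun i n => F i n - G i n).
Proof.
have h : computes (fun _ w => (csnd (csnd w)).-1).
  by apply: computes_pred; projections.
move=> hF hG; have := @computes_rec _ _ (fun _ _ _ s => s.-1) hF hG h.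
apply: computes_ext => i n.
by elim: (G i n) => [|k /= ->]; rewrite ?subn0 ?subnS.
Qed.

Lemma computes_mul F G : computes F -> computes G ->
  computes (fun i n => F i n * G i n).
Proof.
move=> hF hG; have h : computes (fun i w => csnd (csnd w) + F i (cfst w)).
  by apply: computes_add; [projections|apply: computes_comp => //; projections].
have := @computes_rec _ _ (fun i n _ s => s + F i n) (computes_const 0) hG h.
apply: computes_ext => i n.
by elim: (G i n) => [|k /= ->]; rewrite ?muln0 ?mulnS 1?addnC.
Qed.

Lemma computes_exp c F : computes F -> computes (fun i n => c ^ F i n).
Proof.
have h : computes (fun i w => c * csnd (csnd w)).
  by apply: computes_mul; [exact: computes_const|projections].
move=> hF.
have := @computes_rec _ _ (fun _ _ _ s => c * s) (computes_const 1) hF h.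
by apply: computes_ext => i n; elim: (F i n) => [|k /= ->] //; rewrite expnS.
Qed.

Lemma computes_eq0 F : computes F -> computes (fun i n => F i n == 0).
Proof.
move=> hF; have := @computes_rec _ _ (fun _ _ _ _ => 0) (computes_const 1) hF
  (computes_const 0).
by apply/computes_ext => i n; case: (F i n).
Qed.

Lemma computes_leq F G : computes F -> computes G ->
  computes (fun i n => F i n <= G i n).
Proof. by move=> hF hG; rewrite /leq; exact/computes_eq0/computes_sub. Qed.

Lemma computes_neg b : computes b -> computes (fun i n => ~~ b i n).
Proof.
move=> /computes_eq0; apply/computes_ext => i n; by case: (b i n).
Qed.

Lemma computes_and a b : computes a -> computes b ->
  computes (fun i n => a i n && b i n).
Proof.
move=> ha hb; have := computes_mul ha hb; apply/computes_ext => i n.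
by case: (a i n); case: (b i n).
Qed.

Lemma computes_or a b : computes a -> computes b ->
  computes (fun i n => a i n || b i n).
Proof.
move=> /computes_neg ha /computes_neg hb.
have := computes_neg (computes_and ha hb); apply/computes_ext => i n.
by rewrite negb_and !negbK.
Qed.

Lemma computes_eqn F G : computes F -> computes G ->
  computes (fun i n => F i n == G i n).
Proof.
move=> hF hG; have := computes_and (computes_leq hF hG) (computes_leq hG hF).
by apply/computes_ext => i n; rewrite eqn_leq.
Qed.

End Computes.

(* Dispatch on the head symbol: trying the rules blindly is far too slow. *)
Ltac computes_rule :=
  lazymatch goal with
  | |- computes _ (fun i n => n) => exact: computes_id
  | |- computes ?O (fun _ => cfst) => change (computes O (fun _ n => cfst n))
  | |- computes ?O (fun _ => csnd) => change (computes O (fun _ n => csnd n))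
  | |- computes _ (fun i n => S (@?F i n)) => apply: (@computes_succ _ _ F)
  | |- computes _ (fun i n => predn (@?F i n)) => apply: (@computes_pred _ _ F)
  | |- computes _ (fun i n => cfst (@?F i n)) => apply: (@computes_fst _ _ F)
  | |- computes _ (fun i n => csnd (@?F i n)) => apply: (@computes_snd _ _ F)
  | |- computes _ (fun i n => cpair (@?F i n) (@?G i n)) =>
      apply: (@computes_pair _ _ F G)
  | |- computes _ (fun i n => @?F i n + @?G i n) =>
      apply: (@computes_add _ _ F G)
  | |- computes _ (fun i n => @?F i n - @?G i n) =>
      apply: (@computes_sub _ _ F G)
  | |- computes _ (fun i n => @?F i n * @?G i n) =>
      apply: (@computes_mul _ _ F G)
  | |- computes _ (fun i n => ?c ^ @?F i n) => apply: (@computes_exp _ _ c F)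
  | |- computes _ (fun i n => nat_of_bool (@?F i n == @?G i n)) =>
      apply: (@computes_eqn _ _ F G)
  | |- computes _ (fun i n => nat_of_bool (@?F i n <= @?G i n)) =>
      apply: (@computes_leq _ _ F G)
  | |- computes _ (fun i n => nat_of_bool (~~ @?b i n)) =>
      apply: (@computes_neg _ _ b)
  | |- computes _ (fun i n => nat_of_bool (@?a i n && @?b i n)) =>
      apply: (@computes_and _ _ a b)
  | |- computes _ (fun i n => nat_of_bool (@?a i n || @?b i n)) =>
      apply: (@computes_or _ _ a b)
  | |- computes _ (fun _ _ => ?c) => exact: computes_const
  | |- computes _ (fun i n => if _ then _ else _) => apply: computes_if
  end.

Ltac computes_tac := repeat (cbv beta; first [assumption | computes_rule]).

(* [inline r p] runs [p] on the second component of the input, answering every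
   oracle query m by running [r] on the pair of the first component and m. *)
Fixpoint inline (r p : program) : program :=
  match p with
  | PZero => PZero
  | PSucc => PComp PSucc PSnd
  | PFst => PComp PFst PSnd
  | PSnd => PComp PSnd PSnd
  | POracle => r
  | PPair p q => PPair (inline r p) (inline r q)
  | PComp p q => PComp (inline r p) (PPair PFst (inline r q))
  | PRec p q =>
      PComp
        (PRec (inline r p)
          (PComp (inline r q)
             (PPair (PComp PFst PFst) (PPair (PComp PSnd PFst) PSnd))))
        (PPair (PPair PFst (PComp PFst PSnd)) (PComp PSnd PSnd))
  | PMu p =>
      PMu (PComp (inline r p)
             (PPair (PComp PFst PFst) (PPair (PComp PSnd PFst) PSnd)))
  end.

Lemma eval_inline (O G : nat -> bool) r t p x y :
  (forall m, eval O r (cpair t m) (G m)) ->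
  eval G p x y -> eval O (inline r p) (cpair t x) y.
Proof.
move=> hr.
(* [PRec] and [PMu] append their own data to the parameter, so the subprogram input arrives grouped
   to the left and has to be regrouped before [inline] applies to it. *)
have shuffle a b :
    eval O (PPair (PComp PFst PFst) (PPair (PComp PSnd PFst) PSnd))
      (cpair (cpair t a) b) (cpair t (cpair a b)).
  exists t, (cpair a b); split=> //.
    by eexists; [reflexivity|]; rewrite /= !cpairE.
  exists a, b; split=> //; last by rewrite /= cpairE.
  by eexists; [reflexivity|]; rewrite /= !cpairE.
elim: p x y => [||||| p IHp q IHq | p IHp q IHq | p IHp q IHq | p IHp] x y /=.
- by [].
- by move=> ->; eexists; rewrite ?cpairE.
- by move=> ->; eexists; rewrite ?cpairE.
- by move=> ->; eexists; rewrite ?cpairE.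
- by move=> ->.
- by move=> [u [v [/IHp hp /IHq hq ->]]]; exists u, v.
- move=> [u /IHq hq /IHp hp]; exists (cpair t u) => //.
  by exists t, u; rewrite cfst_pair.
- move=> [s [s0 hs ->]].
  exists (cpair (cpair t (cfst x)) (csnd x)).
    exists (cpair t (cfst x)), (csnd x); split=> //; last first.
      by eexists; rewrite ?cpairE.
    by exists t, (cfst x); split; rewrite ?cpairE //; eexists; rewrite ?cpairE.
  exists s; rewrite !cpairE; split=> //; first exact: IHp.
  move=> i ix; exists (cpair t (cpair (cfst x) (cpair i (s i)))).
    exact: shuffle.
  exact/IHq/hs.
- move=> [h0 hl]; split.
    by exists (cpair t (cpair x y)); [exact: shuffle|exact: IHp].
  move=> k /hl[v hv]; exists v.
  by exists (cpair t (cpair x k)); [exact: shuffle|exact: IHp].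
Qed.

(** One program for [F] serves every oracle, so it can be run on an oracle that is itself computed
    from [O i]; the parameter [T i n] of that oracle travels along in the input. *)
Lemma computes_inline I (O : I -> nat -> bool) (G : I -> nat -> nat -> bool)
    (F : (nat -> bool) -> nat -> nat) T N :
  computes id F -> computes O (fun i w => G i (cfst w) (csnd w)) ->
  computes O T -> computes O N ->
  computes O (fun i n => F (G i (T i n)) (N i n)).
Proof.
move=> [p hp] [r hr] hT hN.
suff h : computes O (fun i w => F (G i (cfst w)) (csnd w)).
  have := computes_comp h (computes_pair hT hN).
  by apply: computes_ext => i n; rewrite !cpairE.
exists (inline r p) => i w; rewrite -[X in eval _ _ X](cpair_eta w).
apply: eval_inline (hp _ _) => m.
by have := hr i (cpair (cfst w) m); rewrite !cpairE.
Qed.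

(* Use principle: a halting computation queries only finitely much oracle. *)
Lemma eval_use X p x y : eval X p x y ->
  exists N, forall Y, (forall m, m < N -> Y m = X m) -> eval Y p x y.
Proof.
elim: p x y => [||||| p IHp q IHq | p IHp q IHq | p IHp q IHq | p IHp] x y /=;
  try by move=> h; exists 0.
- by move=> ->; exists x.+1 => Y ->.
- move=> [u [v [/IHp[M hM] /IHq[N hN] ->]]]; exists (maxn M N) => Y hY.
  by exists u, v; split=> //; [apply: hM|apply: hN] => m mM; apply: hY; lia.
- move=> [u /IHq[M hM] /IHp[N hN]]; exists (maxn M N) => Y hY.
  by exists u; [apply: hM|apply: hN] => m mM; apply: hY; lia.
- move=> [s [/IHp[M hM] hs ->]].
  have [N hN] : exists N, forall Y, (forall m, m < N -> Y m = X m) ->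
      forall i, i < csnd x ->
        eval Y q (cpair (cfst x) (cpair i (s i))) (s i.+1).
    elim: (csnd x) hs => [_|n IH hs]; first by exists 0.
    have [N1 hN1] := IH (fun i h => hs i (ltnW h)).
    have [N2 hN2] := IHq _ _ (hs n (ltnSn n)).
    exists (maxn N1 N2) => Y hY i; rewrite ltnS leq_eqVlt => /predU1P[->|lt].
      by apply: hN2 => m mM; apply: hY; lia.
    by apply: hN1 => // m mM; apply: hY; lia.
  exists (maxn M N) => Y hY; exists s.
  by split=> //; [apply: hM|apply: hN] => m mM; apply: hY; lia.
- move=> [/IHp[M hM] hl].
  have [N hN] : exists N, forall Y, (forall m, m < N -> Y m = X m) ->
      forall k, k < y -> exists v, eval Y p (cpair x k) v.+1.
    elim: y hl {hM} => [_|n IH hs]; first by exists 0.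
    have [N1 hN1] := IH (fun i h => hs i (ltnW h)).
    have [v /IHp[N2 hN2]] := hs n (ltnSn n).
    exists (maxn N1 N2) => Y hY i; rewrite ltnS leq_eqVlt => /predU1P[->|lt].
      by exists v; apply: hN2 => m mM; apply: hY; lia.
    by apply: hN1 => // m mM; apply: hY; lia.
  exists (maxn M N) => Y hY.
  by split=> //; [apply: hM|apply: hN] => m mM; apply: hY; lia.
Qed.

(** * A universal machine and Kleene's normal form *)

Definition push (x st : nat) : nat := (cpair x st).+1.

(* A stack of codes to be checked; it is emptied iff all are valid. *)
Definition parse_step (st : nat) : nat :=
  let e := cfst st.-1 in let r := csnd st.-1 in
  if st == 0 then 0
  else if cfst e <= 4 then (if csnd e == 0 then r else st)
  else if cfst e <= 7 then push (cfst (csnd e)) (push (csnd (csnd e)) r)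
  else if cfst e == 8 then push (csnd e) r
  else st.

Lemma iter_parse_step0 n : iter n parse_step 0 = 0.
Proof. by elim: n => //= n ->. Qed.

Lemma parse_complete p r : exists n, iter n parse_step (push (encode p) r) = r.
Proof.
have parse1 t s : t <= 4 -> parse_step (push (cpair t 0) s) = s.
  by move=> t4; rewrite /parse_step/= !cpairE t4.
have parse2 t a b s : 4 < t <= 7 ->
    parse_step (push (cpair t (cpair a b)) s) = push a (push b s).
  by move=> /andP[t4 t7]; rewrite /parse_step/= !cpairE leqNgt t4/= t7.
elim: p r => [||||| p IHp q IHq | p IHp q IHq | p IHp q IHq | p IHp] r;
  try by exists 1; apply: parse1.
1-3: have [n hn] := IHp (push (encode q) r); have [m hm] := IHq r;
  by exists (m + n.+1); rewrite iterD iterSr parse2// hn.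
have [n hn] := IHp r; exists n.+1; rewrite iterSr.
by rewrite /parse_step/= !cpairE.
Qed.

(** Strong induction on the number of steps: parsing the top code uses up at least one step, and the
    rest of the run empties [r]. A nonempty stack that a step leaves unchanged is never emptied. *)
Lemma parse_sound n e r : iter n parse_step (push e r) = 0 ->
  exists2 p, encode p = e & exists2 m, m < n & iter m parse_step r = 0.
Proof.
elim/ltn_ind: n e r => -[//|n] IH e r.
have stuck : parse_step (push e r) = push e r ->
    iter n.+1 parse_step (push e r) <> 0.
  by move=> h; elim: n.+1 => [//|k]; rewrite iterSr h.
have [e4|e4] := leqP (cfst e) 4.
  have [e0|e0] := eqVneq (csnd e) 0; last first.
    by move=> /stuck; case; rewrite /parse_step/= !cpairE e4 (negbTE e0).
  rewrite iterSr {2}/parse_step/= !cpairE e4 e0/= => h.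
  have [p pe] : exists p, encode p = cpair (cfst e) 0.
    move: (cfst e) e4 => -[|[|[|[|[|//]]]]] _.
    + by exists PZero. + by exists PSucc. + by exists PFst.
    + by exists PSnd. + by exists POracle.
  by exists p; [rewrite pe -e0 cpair_eta|exists n].
have [e7|e7] := leqP (cfst e) 7.
  rewrite iterSr {2}/parse_step/= !cpairE leqNgt e4/= e7.
  move=> /(IH _ (ltnSn n))[p pe [m mn /(IH _ (ltnW mn))[q qe [k km kr]]]].
  exists (if cfst e == 5 then PPair p q
     else if cfst e == 6 then PComp p q else PRec p q);
    last by exists k => //; lia.
  rewrite -[RHS]cpair_eta -[csnd e in RHS]cpair_eta -pe -qe.
  by move: (cfst e) e4 e7 => -[|[|[|[|[|[|[|[|]]]]]]]].
have [e8|e8] := eqVneq (cfst e) 8.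
  rewrite iterSr {2}/parse_step/= !cpairE e8/=.
  move=> /(IH _ (ltnSn n))[p pe [m mn mr]].
  exists (PMu p); last by exists m => //; lia.
  by rewrite /= pe -e8 cpair_eta.
move=> /stuck; case.
by rewrite /parse_step/= !cpairE leqNgt e4/= leqNgt e7/= (negbTE e8).
Qed.

(* An abstract machine for programs: a state either evaluates the code e on x
   or returns the value y, to a stack K of pending operations. *)
Definition evaluate (e x K : nat) : nat := cpair 0 (cpair e (cpair x K)).
Definition return_ (y K : nat) : nat := cpair 1 (cpair y K).

Definition pair1_frame (q x : nat) : nat := cpair 0 (cpair q x).
Definition pair2_frame (u : nat) : nat := cpair 1 u.
Definition comp_frame (p : nat) : nat := cpair 2 p.
Definition rec_frame (q a i n : nat) : nat :=
  cpair 3 (cpair q (cpair a (cpair i n))).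
Definition mu_frame (p x k : nat) : nat := cpair 4 (cpair p (cpair x k)).

Definition eval_step (X : nat -> bool) (e x K : nat) : nat :=
  let c := cfst e in let p := cfst (csnd e) in let q := csnd (csnd e) in
  if c == 0 then return_ 0 K
  else if c == 1 then return_ x.+1 K
  else if c == 2 then return_ (cfst x) K
  else if c == 3 then return_ (csnd x) K
  else if c == 4 then return_ (X x) K
  else if c == 5 then evaluate p x (push (pair1_frame q x) K)
  else if c == 6 then evaluate q x (push (comp_frame p) K)
  else if c == 7 then
    evaluate p (cfst x) (push (rec_frame q (cfst x) 0 (csnd x)) K)
  else evaluate (csnd e) (cpair x 0) (push (mu_frame (csnd e) x 0) K).

Definition return_step (y fr K : nat) : nat :=
  let c := cfst fr in let q := cfst (csnd fr) in
  let a := cfst (csnd (csnd fr)) in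
  let i := cfst (csnd (csnd (csnd fr))) in
  let n := csnd (csnd (csnd (csnd fr))) in
  let k := csnd (csnd (csnd fr)) in
  if c == 0 then evaluate q (csnd (csnd fr)) (push (pair2_frame y) K)
  else if c == 1 then return_ (cpair (csnd fr) y) K
  else if c == 2 then evaluate (csnd fr) y K
  else if c == 3 then
    (if i == n then return_ y K
     else evaluate q (cpair a (cpair i y)) (push (rec_frame q a i.+1 n) K))
  else
    (if y == 0 then return_ k K
     else evaluate q (cpair a k.+1) (push (mu_frame q a k.+1) K)).

Definition step (X : nat -> bool) (s : nat) : nat :=
  let d := csnd s in
  if cfst s == 0 then eval_step X (cfst d) (cfst (csnd d)) (csnd (csnd d))
  else if csnd d == 0 then s
  else return_step (cfst d) (cfst (csnd d).-1) (csnd (csnd d).-1).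

Definition halted (s : nat) : bool := (cfst s != 0) && (csnd (csnd s) == 0).

Lemma step_evaluate X e x K : step X (evaluate e x K) = eval_step X e x K.
Proof. by rewrite /step /evaluate !cpairE. Qed.

Lemma step_return X y fr K :
  step X (return_ y (push fr K)) = return_step y fr K.
Proof. by rewrite /step /return_ /push !(cpairE, succnK). Qed.

Lemma halted_step X s : halted s -> step X s = s.
Proof. by rewrite /step => /andP[/negbTE-> ->]. Qed.

Lemma halted_evaluate e x K : halted (evaluate e x K) = false.
Proof. by rewrite /halted /evaluate cpairE. Qed.

Lemma halted_return_push y fr K : halted (return_ y (push fr K)) = false.
Proof. by rewrite /halted /return_ !cpairE. Qed.

Lemma eval_stepE X x K :
  (eval_step X (encode PZero) x K = return_ 0 K) *
  (eval_step X (encode PSucc) x K = return_ x.+1 K) *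
  (eval_step X (encode PFst) x K = return_ (cfst x) K) *
  (eval_step X (encode PSnd) x K = return_ (csnd x) K) *
  (eval_step X (encode POracle) x K = return_ (X x) K) *
  (forall p q, eval_step X (encode (PPair p q)) x K =
    evaluate (encode p) x (push (pair1_frame (encode q) x) K)) *
  (forall p q, eval_step X (encode (PComp p q)) x K =
    evaluate (encode q) x (push (comp_frame (encode p)) K)) *
  (forall p q, eval_step X (encode (PRec p q)) x K =
    evaluate (encode p) (cfst x)
      (push (rec_frame (encode q) (cfst x) 0 (csnd x)) K)) *
  (forall p, eval_step X (encode (PMu p)) x K =
    evaluate (encode p) (cpair x 0) (push (mu_frame (encode p) x 0) K)).
Proof. by do ![split]; move=> *; rewrite /eval_step/= !cpairE. Qed.

Lemma return_stepE y K :
  (forall q x, return_step y (pair1_frame q x) K =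
    evaluate q x (push (pair2_frame y) K)) *
  (forall u, return_step y (pair2_frame u) K = return_ (cpair u y) K) *
  (forall p, return_step y (comp_frame p) K = evaluate p y K) *
  (forall q a n, return_step y (rec_frame q a n n) K = return_ y K) *
  (forall q a i n, i != n -> return_step y (rec_frame q a i n) K =
    evaluate q (cpair a (cpair i y)) (push (rec_frame q a i.+1 n) K)) *
  (forall p x k, return_step y (mu_frame p x k) K =
    if y == 0 then return_ k K
    else evaluate p (cpair x k.+1) (push (mu_frame p x k.+1) K)).
Proof.
do ![split]; move=> >;
  rewrite /return_step /pair1_frame /pair2_frame /comp_frame /rec_frame
    /mu_frame !cpairE ?eqxx //.
by move=> /negbTE->.
Qed.

(** Leaving [K] arbitrary lets the run of a subprogram take place below the frames of its caller. *)
Lemma machine_complete X p x y : eval X p x y ->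
  forall K, exists n, iter n (step X) (evaluate (encode p) x K) = return_ y K.
Proof.
elim: p x y => [||||| p IHp q IHq | p IHp q IHq | p IHp q IHq | p IHp] x y ev K;
  try by exists 1; rewrite iterS step_evaluate eval_stepE ev.
- have [u [v [/IHp hp /IHq hq ->]]] := ev.
  have [n hn] := hp (push (pair1_frame (encode q) x) K).
  have [m hm] := hq (push (pair2_frame u) K).
  exists ((m.+1 + n.+1).+1).
  rewrite iterS iterD [iter n.+1 _ _]iterSr step_evaluate eval_stepE hn.
  by rewrite iterSr step_return return_stepE hm step_return return_stepE.
- have [u /IHq hq /IHp hp] := ev.
  have [n hn] := hq (push (comp_frame (encode p)) K).
  have [m hm] := hp K.
  exists (m.+1 + n.+1).
  rewrite iterD [iter n.+1 _ _]iterSr step_evaluate eval_stepE hn.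
  by rewrite iterSr step_return return_stepE.
- have [s [/IHp hp hs ->]] := ev.
  set fr := rec_frame (encode q) (cfst x).
  have [m hm] : exists m, iter m (step X) (evaluate (encode (PRec p q)) x K) =
      return_ (s (csnd x)) (push (fr (csnd x) (csnd x)) K).
    have: csnd x <= csnd x by []; elim: {1 3 4}(csnd x) => [_|i IH ix].
      have [m hm] := hp (push (fr 0 (csnd x)) K).
      by exists m.+1; rewrite iterSr step_evaluate eval_stepE.
    have [m hm] := IH (ltnW ix).
    have [k hk] := IHq _ _ (hs i ix) (push (fr i.+1 (csnd x)) K).
    exists (k.+1 + m); rewrite iterD hm iterSr step_return return_stepE//.
    by rewrite neq_ltn ix.
  by exists m.+1; rewrite iterS hm step_return return_stepE.
- have [hy hl] := ev; set fr := mu_frame (encode p) x.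
  have [m hm] : exists m, iter m (step X) (evaluate (encode (PMu p)) x K) =
      evaluate (encode p) (cpair x y) (push (fr y) K).
    elim: {hy ev} y hl => [_|k IH hl].
      by exists 1; rewrite iterS step_evaluate eval_stepE.
    have [m hm] := IH (fun i h => hl i (ltnW h)).
    have [v /IHp hv] := hl k (ltnSn k); have [n hn] := hv (push (fr k) K).
    by exists (n.+1 + m); rewrite iterD hm iterS hn step_return return_stepE.
  have [n hn] := IHp _ _ hy (push (fr y) K).
  by exists (n.+1 + m); rewrite iterD hm iterS hn step_return return_stepE.
Qed.

(** A halting run has to return from each subprogram it enters, and what remains of it is strictly
    shorter; this decrease drives the inner inductions for [PRec] and [PMu]. *)
Lemma machine_sound X n p x K :
  halted (iter n (step X) (evaluate (encode p) x K)) ->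
  exists2 y, eval X p x y &
    exists2 m, m < n & halted (iter m (step X) (return_ y K)).
Proof.
have ret k y fr J : halted (iter k (step X) (return_ y (push fr J))) ->
    exists2 k', k' < k & halted (iter k' (step X) (return_step y fr J)).
  by case: k => [|k]; [rewrite /= halted_return_push
    |rewrite iterSr step_return; exists k].
elim: p n x K =>
  [||||| p IHp q IHq | p IHp q IHq | p IHp q IHq | p IHp] [|n] x K;
  rewrite ?[iter 0 _ _]/= ?halted_evaluate// iterSr step_evaluate eval_stepE;
  try by (move=> h; eexists; [reflexivity|exists n]).
- move=> /IHp[u hu [m mn /ret[k km]]]; rewrite return_stepE.
  move=> /IHq[v hv [m' mk /ret[k' km']]]; rewrite return_stepE => h.
  by exists (cpair u v); [exists u, v|exists k' => //; lia].
- move=> /IHq[u hu [m mn /ret[k km]]]; rewrite return_stepE.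
  move=> /IHp[v hv [m' mk h]].
  by exists v; [exists u|exists m' => //; lia].
- set a := cfst x; set c := csnd x; move=> /IHp[u0 hu0 [m0 mn0 hm0]].
  suff loop m i s : m < n -> i <= c ->
      halted (iter m (step X)
        (return_ (s i) (push (rec_frame (encode q) a i c) K))) ->
      eval X p a (s 0) ->
      (forall j, j < i -> eval X q (cpair a (cpair j (s j))) (s j.+1)) ->
      exists2 y, eval X (PRec p q) x y &
        exists2 m, m < n.+1 & halted (iter m (step X) (return_ y K)).
    by apply: (loop m0 0 (fun=> u0)).
  elim/ltn_ind: m i s => m IH i s mn ic hm s0 hs.
  have [k km] := ret _ _ _ _ hm.
  have [ic'|ic'] := eqVneq i c.
    rewrite ic' return_stepE => h.
    by exists (s c); [exists s; rewrite -/c -ic'|exists k => //; lia].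
  rewrite return_stepE// => /IHq[v hv [m' mk hm']].
  apply: (IH m' _ i.+1 (fun j => if j <= i then s j else v)) => //;
    [lia|lia| | |].
  - by rewrite ltn_neqAle ic' ic.
  - by rewrite ltnn.
  - move=> j; rewrite ltnS leq_eqVlt => /predU1P[->|ji].
      by rewrite eqxx ltnn.
    by rewrite ji orbT; exact: hs.
- suff loop m k : m <= n ->
      halted (iter m (step X) (evaluate (encode p) (cpair x k)
        (push (mu_frame (encode p) x k) K))) ->
      (forall j, j < k -> exists v, eval X p (cpair x j) v.+1) ->
      exists2 y, eval X (PMu p) x y &
        exists2 m, m < n.+1 & halted (iter m (step X) (return_ y K)).
    by move=> h; exact: (loop n 0).
  elim/ltn_ind: m k => m IH k mn /IHp[[|u] hu [i im /ret[j ji]]];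
    rewrite return_stepE /= => h hk.
    by exists k => //; exists j => //; lia.
  apply: (IH j _ k.+1 _ h); [lia|lia|].
  by move=> l; rewrite ltnS leq_eqVlt => /predU1P[->|/hk//]; exists u.
Qed.

(** The machine reads every code that it does not recognise as a minimisation, so the validity of
    [e] is checked separately. One stage bounds both the check and the run. *)
Definition kleeneT (X : nat -> bool) (w : nat) : bool :=
  let e := cfst w in
  (iter (csnd w) parse_step (push e 0) == 0) &&
  halted (iter (csnd w) (step X) (evaluate e e 0)).

Lemma kleeneT0 X e : kleeneT X (cpair e 0) = false.
Proof. by rewrite /kleeneT !cpairE. Qed.

Lemma kleeneT_mono X e s t : s <= t ->
  kleeneT X (cpair e s) -> kleeneT X (cpair e t).
Proof.
move=> /subnK<-; rewrite /kleeneT !cpairE !iterD => /andP[/eqP-> h].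
rewrite iter_parse_step0 eqxx /=.
by elim: (t - s) => //= k ih; rewrite halted_step.
Qed.

Lemma jumpP X e : jump X e <-> exists s, kleeneT X (cpair e s).
Proof.
split=> [/asboolP[y [p <- h]]|[s]].
  have [n hn] := machine_complete h 0; have [m hm] := parse_complete p 0.
  (* The sum serves both runs because the empty stack and the halted states are fixed points. *)
  exists (n + m); rewrite /kleeneT !cpairE iterD hm iter_parse_step0 /=.
  rewrite addnC iterD hn.
  by elim: m {hm} => [|m]; [rewrite /halted /return_ !cpairE|
     rewrite iterS => h'; rewrite halted_step].
rewrite /kleeneT !cpairE.
move=> /andP[/eqP/parse_sound[p <- _] /machine_sound[y h _]].
by apply/asboolP; exists y, p.
Qed.

Lemma computes_step : computes id step.
Proof.
rewrite /step /eval_step /return_step /evaluate /return_ /push /pair1_frame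
  /pair2_frame /comp_frame /rec_frame /mu_frame; cbv zeta.
by computes_tac; apply: (@computes_oracle _ id); computes_tac.
Qed.

Lemma computes_iter I (O : I -> nat -> bool) (f : I -> nat -> nat) N F :
  computes O f -> computes O N -> computes O F ->
  computes O (fun i n => iter (N i n) (f i) (F i n)).
Proof.
move=> hf hN hF; have h : computes O (fun i w => f i (csnd (csnd w))).
  by apply: computes_comp => //; computes_tac.
have := @computes_rec _ _ _ _ (fun i _ _ s => f i s) hF hN h.
by apply: computes_ext => i n; elim: (N i n) => //= k ->.
Qed.

Lemma computes_kleeneT : computes id (fun X n => kleeneT X n).
Proof.
rewrite /kleeneT /halted /evaluate /push; have hs := computes_step.
have hp : computes (id : (nat -> bool) -> _) (fun _ => parse_step).
  by rewrite /parse_step /push; cbv zeta; computes_tac.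
cbv zeta; computes_tac; (apply: computes_iter; [assumption| |]); computes_tac.
Qed.

(** * The jump and the double jump *)

(** An instance of the s-m-n theorem: [c m] codes a program that ignores its input, produces [m],
    and searches for the least [s] with [b] true. As [p] is the same for all [i], so is [c], and no
    oracle is used to compute it. *)
Lemma jump_code I (O : I -> nat -> bool) (b : I -> nat -> bool) :
  computes O (fun i n => b i n) ->
  exists2 c, computable c &
    forall i m, jump (O i) (c m) <-> exists s, b i (cpair m s).
Proof.
move=> /computes_neg[p hp].
(* The numbers are the codes of [PComp], [PSucc] and [PZero]. *)
pose const_code n :=
  iter n (fun r => cpair 6 (cpair (cpair 1 0) r)) (cpair 0 0).
have const_codeE n : const_code n = encode (iter n (PComp PSucc) PZero).
  by elim: n => //= n <-.
have eval_const X n x y : eval X (iter n (PComp PSucc) PZero) x y <-> y = n.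
  elim: n y => //= n IH y; split=> [[u /IH-> ->//]|->].
  by exists n => //; apply/IH.
exists (fun m => cpair 6 (cpair (encode (PMu p)) (const_code m))).
  have [q hq] : computes (fun _ : unit => emptyset)
      (fun _ m => cpair 6 (cpair (encode (PMu p)) (const_code m))).
    have h : computes (fun _ : unit => emptyset) (fun _ => const_code).
      apply: (@computes_iter _ _ (fun _ r => cpair 6 (cpair (cpair 1 0) r))
        (fun _ m => m) (fun _ _ => cpair 0 0)); computes_tac.
    computes_tac.
  by exists q; exact: hq tt.
move=> i m; rewrite const_codeE.
have -> : cpair 6 (cpair (encode (PMu p)) (encode (iter m (PComp PSucc) PZero)))
  = encode (PComp (PMu p) (iter m (PComp PSucc) PZero)) by [].
set e := encode _.
split=> [/asboolP[y [q /encode_inj-> [u /eval_const-> []]]]|].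
  move=> h _; exists y; apply/negbNE/negP => h'.
  by have := eval_functional h (hp i (cpair m y)); rewrite h'.
move=> [s0 hs0]; have hs : exists s, b i (cpair m s) by exists s0.
case: (ex_minnP hs) => s bs smin.
apply/asboolP; exists s; eexists; first reflexivity.
exists m; first exact/eval_const.
split; first by have := hp i (cpair m s); rewrite bs.
move=> k ks; exists 0; have := hp i (cpair m k).
by case: (boolP (b i _)) => // /smin; rewrite leqNgt ks.
Qed.

Lemma fun_turing_leE f X :
  fun_turing_le f X <-> computes (fun _ : unit => X) (fun=> f).
Proof. by split=> -[p hp]; exists p => // n; exact: (hp tt n). Qed.

(** Halting relative to [Z] is a search over a [Y]-computable predicate, so each condition is a
    single atom and the reduction is even many-one. *)
Lemma jump_tt_le_of_turing_le Z Y : turing_le Z Y -> tt_le (jump Z) (jump Y).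
Proof.
move=> /fun_turing_leE hZ.
have h : computes (fun _ : unit => Y) (fun _ n => kleeneT Z n).
  have hZ' : computes (fun _ : unit => Y) (fun _ w => Z (csnd w)).
    by apply: (computes_comp hZ); computes_tac.
  by apply: (@computes_inline _ _ (fun _ _ => Z) _ (fun _ _ => 0) (fun _ n => n)
    computes_kleeneT hZ'); computes_tac.
have [c hc hcP] := jump_code h.
exists (fun n => TTAtom (c n)); split=> [|n /=].
  by apply/fun_turing_leE; move/fun_turing_leE: hc => hc /=; computes_tac.
by apply/idP/idP; rewrite (hcP tt) jumpP.
Qed.

(* The stage-t approximation to the halting problem. *)
Definition halting_at (t m : nat) : bool := kleeneT emptyset (cpair m t).

(* The guess at stage t for a number v such that
   kleeneT (halting_at t') (e, v) holds for all large t'. *)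
Definition guess (e t : nat) : nat :=
  iteri t (fun t i => if kleeneT (halting_at t) (cpair e i) then i else i.+1) 0.

Lemma guess_mono e s t : s <= t -> guess e s <= guess e t.
Proof.
move=> /subnK<-; elim: (t - s) => //= k IH; apply: leq_trans IH _.
by rewrite /guess/= -/(guess e _); case: ifP.
Qed.

Lemma guess_le e t : guess e t <= t.
Proof.
by elim: t => //= t IH; rewrite /guess/= -/(guess e _); case: ifP => _; lia.
Qed.

Lemma halting_limit N : exists w, forall t, w <= t ->
  forall m, m < N -> halting_at t m = jump emptyset m.
Proof.
elim: N => [|N [w hw]]; first by exists 0.
have [w' hw'] : exists w', forall t, w' <= t ->
    halting_at t N = jump emptyset N.
  have [/jumpP[s hs]|h] := boolP (jump emptyset N).
    by exists s => t st; apply: kleeneT_mono hs.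
  exists 0 => t _; apply/negbTE; apply: contra h => ht; apply/jumpP.
  by exists t.
exists (maxn w w') => t ht m; rewrite ltnS leq_eqVlt => /predU1P[->|mN].
  by apply: hw'; lia.
by apply: hw => //; lia.
Qed.

(** By the use principle the test reads only a finite part of its oracle, and on that part the
    approximations are eventually correct. *)
Lemma kleeneT_limit w : exists t0, forall t, t0 <= t ->
  kleeneT (halting_at t) w = kleeneT (jump emptyset) w.
Proof.
have [p hp] := computes_kleeneT.
have [N hN] := eval_use (hp (jump emptyset) w).
have [t0 ht0] := halting_limit N; exists t0 => t ht.
have h := hN _ (ht0 t ht).
by have := eval_functional h (hp _ w); case: kleeneT; case: kleeneT.
Qed.

(** The guess moves up exactly when its current value fails the test, so it settles iff some value
    eventually always passes. *)
Lemma jump_jumpP e : jump (jump emptyset) e <->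
  exists u, forall t, u <= t -> guess e t = guess e u.
Proof.
split=> [/jumpP[s0 hs0]|[u hu]].
  have [t0 ht0] := kleeneT_limit (cpair e s0).
  pose v := maxn s0 t0.
  have hv t : v <= t -> kleeneT (halting_at t) (cpair e v).
    move=> vt; apply: kleeneT_mono (leq_maxl s0 t0) _.
    by rewrite ht0//; apply: leq_trans vt; apply: leq_maxr.
  (* The guess at stage [t] is at most [t], so it can equal [v] only at a stage [t >= v], where [v]
     passes the test and the guess stays. *)
  have bounded t : guess e t <= v.
    elim: t => // t IH; rewrite /guess/= -/(guess e t).
    case: ifPn => // h; rewrite ltn_neqAle IH andbT; apply: contra h => /eqP gv.
    by rewrite gv; apply: hv; rewrite -gv; exact: guess_le.
  have exv : exists k, `[< exists t, guess e t = k >].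
    by exists (guess e 0); apply/asboolP; exists 0.
  have ub k : `[< exists t, guess e t = k >] -> k <= v.
    by move=> /asboolP[t <-].
  case: (ex_maxnP exv ub) => k /asboolP[u uk] kmax; exists u => t ut.
  apply/eqP; rewrite eqn_leq [X in _ && X]guess_mono// andbT uk.
  by apply: kmax; apply/asboolP; exists t.
apply/jumpP; exists (guess e u).
(* At a stage beyond both [u] and [t0] the guess does not move, so it passes the test, and there the
   test agrees with the true one. *)
have [t0 ht0] := kleeneT_limit (cpair e (guess e u)).
rewrite -(ht0 (maxn u t0)) ?leq_maxr//.
have := hu (maxn u t0).+1 (leqW (leq_maxl _ _)).
rewrite {1}/guess/= -/(guess e _) (hu (maxn u t0)) ?leq_maxl//.
by case: ifP => // _ /esym/n_Sn.
Qed.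

(* Says of w = <e, u> that u is not the last stage at which the guess
   changed. *)
Definition refuted (w s : nat) : bool :=
  let e := cfst w in let u := csnd w in
  (guess e u.+1 == guess e u) || (guess e u.+1 < guess e s).

Lemma refutedE e u s : refuted (cpair e u) s =
  (guess e u.+1 == guess e u) || (guess e u.+1 < guess e s).
Proof. by rewrite /refuted !cpairE. Qed.

Lemma refuted_mono w s t : s <= t -> refuted w s -> refuted w t.
Proof.
by move=> st /orP[h|h]; rewrite /refuted ?h//= (leq_trans h) ?orbT// guess_mono.
Qed.

Lemma jump_jump_unrefuted e : jump (jump emptyset) e <->
  exists u, forall s, ~~ refuted (cpair e u) s.
Proof.
rewrite jump_jumpP; split=> [hu|[u hu]].
  have [[|u] hmin umin] : exists2 u,
      (forall t, u <= t -> guess e t = guess e u) &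
      forall v, (forall t, v <= t -> guess e t = guess e v) -> u <= v.
    have hu' : exists u, `[< forall t, u <= t -> guess e t = guess e u >].
      by have [u h] := hu; exists u; apply/asboolP.
    case: (ex_minnP hu') => u /asboolP h umin; exists u => // v hv.
    by apply: umin; apply/asboolP.
  (* No computation halts within 0 steps, so the guess always moves at stage 0; hence a guess that
     settles has a last change. *)
  - have := hmin 1 isT; rewrite /guess/=.
    by rewrite kleeneT0.
  - exists u => s; rewrite refutedE negb_or -leqNgt.
    apply/andP; split; last first.
      have [us|su] := leqP u.+1 s; first by rewrite hmin.
      by rewrite guess_mono// ltnW.
    apply/eqP => h; suff : u.+1 <= u by rewrite ltnn.
    apply: umin => t; rewrite leq_eqVlt => /predU1P[->//|/hmin->//].
exists u.+1 => t ut; apply/eqP; rewrite eqn_leq [X in _ && X]guess_mono// andbT.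
by have := hu t; rewrite refutedE negb_or -leqNgt => /andP[].
Qed.

(** If the guess changes at both [a] and [b] with [a < b], then the change at [b] refutes [a] at
    stage [b.+1]. *)
Lemma unrefuted_unique e u v : (forall s, ~~ refuted (cpair e u) s) ->
  (forall s, ~~ refuted (cpair e v) s) -> u = v.
Proof.
suff lt a b : a < b -> (forall s, ~~ refuted (cpair e a) s) ->
    (forall s, ~~ refuted (cpair e b) s) -> False.
  by move=> hu hv; case: (ltngtP u v) => // /lt; move=> /(_ _ _)[].
move=> ab /(_ b.+1) + /(_ 0); rewrite !refutedE => /norP[_ +] /norP[hb _].
rewrite -leqNgt => h; case/negP: hb.
rewrite eqn_leq [X in _ && X]guess_mono// andbT (leq_trans h)// guess_mono//.
Qed.

Lemma computes_refuted I (O : I -> nat -> bool) :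
  computes O (fun _ w => refuted (cfst w) (csnd w)).
Proof.
(* The constantly false oracle is supplied by [inline], so [O] is never queried. *)
have hE : computes O (fun _ w => halting_at (cfst w) (csnd w)).
  apply: (@computes_inline _ _ (fun _ _ _ => false) _ (fun _ _ => 0)
    (fun _ w => cpair (csnd w) (cfst w)) computes_kleeneT); computes_tac.
have hg : computes O (fun _ w => guess (cfst w) (csnd w)).
  apply: (@computes_rec _ _ (fun _ _ => 0) (fun _ w => csnd w)
    (fun _ w t i => if kleeneT (halting_at t) (cpair (cfst w) i)
                    then i else i.+1)); computes_tac.
  apply: (@computes_inline _ _ (fun _ => halting_at) _
    (fun _ w => cfst (csnd w))
    (fun _ w => cpair (cfst (cfst w)) (csnd (csnd w)))
    computes_kleeneT hE); computes_tac.
have hgEN E N : computes O (fun _ => E) -> computes O (fun _ => N) ->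
    computes O (fun _ w => guess (E w) (N w)).
  move=> hE' hN; have := computes_comp hg (computes_pair hE' hN).
  by apply: computes_ext => i w; rewrite !cpairE.
by rewrite /refuted; cbv zeta; computes_tac; apply: hgEN; computes_tac.
Qed.

Lemma computes_count I (O : I -> nat -> bool) (b : I -> nat -> nat -> bool) N :
  computes O (fun i w => b i (cfst w) (csnd w)) -> computes O N ->
  computes O (fun i n => count (b i n) (iota 0 (N i n))).
Proof.
move=> hb hN.
have hb' : computes O (fun i w => b i (cfst w) (cfst (csnd w))).
  have := computes_comp hb (computes_pair (computes_fst (computes_id O))
    (computes_fst (computes_snd (computes_id O)))).
  by apply: computes_ext => i n; rewrite !cpairE.
have h : computes O (fun i w => csnd (csnd w) + b i (cfst w) (cfst (csnd w))).
  by computes_tac.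
have := @computes_rec _ _ (fun _ _ => 0) _ (fun i n u r => r + b i n u)
  (computes_const O 0) hN h.
apply: computes_ext => i n; elim: (N i n) => // k IH.
by rewrite -[X in iota _ X]addn1 iotaD count_cat -IH /= addn0.
Qed.

(** * From a trace with bounded sections to a truth-table reduction *)

Definition unrefuted (w : nat) : Prop := forall s, ~~ refuted w s.

(* The number of elements of the e-th section of W is compared with the number
   of those that get refuted; both are limits of nondecreasing counts. *)
Lemma jump_jump_tt_le_of_trace (Z W : nat -> bool) (c : nat) :
  turing_le W Z ->
  (forall e n, count (fun u => W (cpair e u)) (iota 0 n) <= c * 2 ^ e.+2) ->
  (forall w, unrefuted w -> W w) ->
  tt_le (jump (jump emptyset)) (jump Z).
Proof.
move=> /fun_turing_leE hW bound trace.
pose inW e (u : nat) := W (cpair e u).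
pose ref e (s u : nat) := inW e u && refuted (cpair e u) s.
pose a (_ : unit) w :=
  csnd (cfst w) <= count (inW (cfst (cfst w))) (iota 0 (csnd w)).
pose b (_ : unit) w :=
  csnd (cfst w) <= count (ref (cfst (cfst w)) (csnd w)) (iota 0 (csnd w)).
have hE : computes (fun _ : unit => Z)
    (fun _ w => inW (cfst (cfst (cfst w))) (csnd w)).
  by apply: (computes_comp hW); computes_tac.
have ha : computes (fun _ : unit => Z) (fun i w => a i w).
  rewrite /a; computes_tac.
  apply: (@computes_count _ _ (fun _ w => inW (cfst (cfst w))));
    computes_tac.
have hb : computes (fun _ : unit => Z) (fun i w => b i w).
  rewrite /b; computes_tac.
  apply: (@computes_count _ _ (fun _ w => ref (cfst (cfst w)) (csnd w)));
    computes_tac.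
  rewrite /ref; computes_tac.
  have := computes_comp (computes_refuted (fun _ : unit => Z))
    (computes_pair (computes_pair (computes_fst (computes_fst
      (computes_fst (computes_id _)))) (computes_snd (computes_id _)))
      (computes_snd (computes_fst (computes_id _)))).
  by apply: computes_ext => i w; rewrite !cpairE.
have [A /fun_turing_leE hA hAP] := jump_code ha.
have [B /fun_turing_leE hB hBP] := jump_code hb.
have aP e k : jump Z (A (cpair e k)) <->
    exists s, k <= count (inW e) (iota 0 s).
  by rewrite (hAP tt) /a; split=> -[s]; rewrite ?cpairE => h; exists s;
    rewrite ?cpairE.
have bP e k : jump Z (B (cpair e k)) <->
    exists s, k <= count (ref e s) (iota 0 s).
  by rewrite (hBP tt) /b; split=> -[s]; rewrite ?cpairE => h; exists s;
    rewrite ?cpairE.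
(* True iff the section has at least [k] elements but at no stage [k] refuted ones; both atoms are
   searches relative to [Z]. *)
pose clause e k :=
  TTAnd (TTAtom (A (cpair e k))) (TTNot (TTAtom (B (cpair e k)))).
pose form e :=
  iteri (c * 2 ^ e.+2) (fun k t => TTOr t (clause e k.+1)) (clause e 0).
exists form; split.
  pose enc e k := cpair 2 (cpair (cpair 0 (A (cpair e k)))
    (cpair 1 (cpair 0 (B (cpair e k))))).
  have henc E K : computes (fun _ : unit => emptyset) (fun _ => E) ->
      computes (fun _ : unit => emptyset) (fun _ => K) ->
      computes (fun _ : unit => emptyset) (fun _ n => enc (E n) (K n)).
    move=> hE' hK; rewrite /enc; computes_tac;
      [apply: (@computes_comp _ _ (fun=> A))
      |apply: (@computes_comp _ _ (fun=> B))];
      computes_tac.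
  apply/fun_turing_leE.
  apply: (@computes_ext _ _ (fun _ e => iteri (c * 2 ^ e.+2)
    (fun k r => cpair 3 (cpair r (enc e k.+1))) (enc e 0))) => [_ e|].
    by rewrite /form; elim: (c * _) => //= k ->.
  apply: (@computes_rec _ _ _ _
    (fun _ e k r => cpair 3 (cpair r (enc e k.+1)))); computes_tac;
    apply: henc; computes_tac.
have formP e : tt_sat (jump Z) (form e) <->
    exists2 k, k <= c * 2 ^ e.+2 & tt_sat (jump Z) (clause e k).
  rewrite /form; elim: (c * _) => [|n IH].
    by split=> [h|[k]]; [exists 0|rewrite leqn0 => /eqP->].
  split=> [/= /orP[/IH[k kn h]|h]|[k]].
  - by exists k => //; exact: leqW.
  - by exists n.+1.
  - rewrite leq_eqVlt => /predU1P[->|kn] h; apply/orP; [by right|left].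
    by apply/IH; exists k.
move=> e; apply/idP/idP => [/jump_jump_unrefuted[u hu]|/formP[k _ /andP[]]].
  have Wu : inW e u := trace _ hu.
  have ex : exists k, `[< exists s, count (inW e) (iota 0 s) = k >].
    by exists 0; apply/asboolP; exists 0.
  have ub k : `[< exists s, count (inW e) (iota 0 s) = k >] ->
      k <= c * 2 ^ e.+2.
    by move=> /asboolP[s <-]; exact: bound.
  (* This [k] is the size of the section, which [bound] makes finite. *)
  case: (ex_maxnP ex ub) => k hk kmax; apply/formP; exists k; first exact: ub.
  apply/andP; split; first by apply/aP; have /asboolP[s <-] := hk; exists s.
  apply/negP => /bP[s hs].
  (* If [k] elements were refuted, then the unrefuted [u] would be one more element of the section;
     [t] is large enough to list them all. *)
  pose t := maxn s u.+1; have st : t = s + (t - s) by rewrite subnKC// leq_maxl.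
  suff : k < count (inW e) (iota 0 t).
    by rewrite ltnNge kmax//; apply/asboolP; exists t.
  have kt : k <= count (ref e s) (iota 0 t).
    by apply: leq_trans hs _; rewrite st iotaD count_cat leq_addr.
  apply: leq_ltn_trans kt _.
  have ut : count_mem u (iota 0 t) = 1.
    by rewrite count_uniq_mem ?iota_uniq// mem_iota leq0n add0n /t leq_maxr.
  rewrite -addn1 -{1}ut -count_predUI.
  rewrite [X in _ + X](_ : _ = 0) ?addn0.
    by apply: sub_count => v /= /orP[/andP[]//|/eqP->].
  apply: etrans (count_pred0 (iota 0 t)); apply: eq_count => v /=.
  by apply/negP => /andP[/andP[_ h] /eqP vu]; have := hu s; rewrite -vu h.
move=> /aP[s hs] /negP nb; apply/negPn/negP => /negP ne; apply: nb; apply/bP.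
(* Conversely, if [e] is outside the double jump, then every [u] gets refuted, and any [k] elements
   of the section become [k] refuted ones. *)
have allref u : exists t, refuted (cpair e u) t.
  apply: contrapT => h; apply: ne; apply/jump_jump_unrefuted.
  by exists u => t; apply/negP => r; apply: h; exists t.
have [t st ht] : exists2 t, s <= t & forall u, u < s -> refuted (cpair e u) t.
  suff [t ht] : exists t, forall u, u < s -> refuted (cpair e u) t.
    exists (maxn s t); rewrite ?leq_maxl// => u us.
    by apply: refuted_mono (ht _ us); rewrite leq_maxr.
  elim: s {hs} => [|s [t ht]]; first by exists 0.
  have [t' ht'] := allref s; exists (maxn t t') => u.
  rewrite ltnS leq_eqVlt => /predU1P[->|/ht].
    by apply: refuted_mono ht'; rewrite leq_maxr.
  by apply: refuted_mono; rewrite leq_maxl.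
exists t; apply: leq_trans hs _; rewrite -(subnKC st) iotaD count_cat.
apply: leq_trans (leq_addr _ _).
have -> : count (inW e) (iota 0 s) = count (ref e t) (iota 0 s).
  apply: eq_in_count => u; rewrite mem_iota add0n => /andP[_ us].
  by rewrite /ref ht ?andbT.
by rewrite subnKC.
Qed.

(** * Independent events under the fair-coin measure *)

Import Order.TTheory GRing.Theory Num.Theory.
Local Open Scope classical_set_scope.

Definition flip (i : nat) (X : cantor) : cantor :=
  fun n => if n == i then ~~ X n else X n.

Lemma measurable_coordinate (n : nat) : measurable [set X : cantor | X n].
Proof. by apply: sub_sigma_algebra; exists n. Qed.

Lemma measurable_flip (i : nat) :
  measurable_fun [set: cantor] (flip i).
Proof.
apply: (measurability (rT := cantor)) => //.
move=> _ [_ [n ->] <-]; rewrite setTI /flip /preimage /=.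
have [->|_] := eqVneq n i; last exact: measurable_coordinate.
rewrite (_ : [set X | _] = ~` [set X : cantor | X i]).
  by apply: measurableC; exact: measurable_coordinate.
by apply/seteqP; split=> X /= /negP.
Qed.

HB.instance Definition _ (i : nat) :=
  isMeasurableFun.Build _ _ _ _ (flip i) (measurable_flip i).

(** Flipping a coordinate carries cylinders to cylinders of the same length, hence of the same
    measure; the cylinders with the empty set form a generating pi-system, on which measures are
    determined. *)
Lemma coin_flip (R : realType) i (A : set cantor) : measurable A ->
  coin R (flip i @^-1` A) = coin R A.
Proof.
pose cyl (s : nat -> bool) n :=
  [set X : nat -> bool | forall j, (j < n)%N -> X j = s j].
pose G : set (set cantor) := [set A | A = set0 \/ exists s n, A = cyl s n].
have mcyl s n : measurable (cyl s n : set cantor).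
  rewrite (_ : cyl s n = \bigcap_(j in `I_n)
      (if s j then [set X : cantor | X j] else ~` [set X : cantor | X j])).
    apply: bigcap_measurableType => j _.
    case: (s j); first exact: measurable_coordinate.
    by apply: measurableC; exact: measurable_coordinate.
  apply/seteqP; split=> X /= h j /= /h.
    by case: (s j) => /= -> //.
  by case: (s j) => //= /negP/negbTE.
have GM : (measurable : set (set cantor)) = <<s G >>.
  apply/seteqP; split=> B; last first.
    apply: smallest_sub; first exact: sigma_algebra_measurable.
    by move=> _ [->|[s [n ->]]]//; exact: measurable0.
  apply: smallest_sub; first exact: smallest_sigma_algebra.
  move=> _ [n ->].
  (* A coordinate set is the union of the cylinders given by the finitely many prefixes of length
     [n.+1] that end in [true]. *)
  pose T := [set t : n.+1.-tuple bool | nth false t n].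
  rewrite (_ : [set X | _] = \bigcup_(t in T) cyl (nth false t) n.+1).
    rewrite bigcup_mkcond.
    have := @countable_bigcupT_measurable _ (g_sigma_algebraType G) _
      (fun t => if t \in T then cyl (nth false t) n.+1 else set0).
    apply => // t; case: ifP => _; apply: sub_sigma_algebra; last by left.
    by right; exists (nth false t), n.+1.
  apply/seteqP; split=> X /=.
    pose restr (j : 'I_n.+1) := X j.
    move=> Xn; exists (mktuple restr) => [|j jn].
      by have := nth_mktuple restr false ord_max; rewrite /T /= => ->.
    by have := nth_mktuple restr false (Ordinal jn); rewrite /= => ->.
  by move=> [t /= tn h]; rewrite h.
move=> mA; rewrite -[LHS]/(distribution (coin R) (flip i) A).
apply: (@measure_unique _ R cantor G (fun=> setT)) => //.
- move=> _ _ [->|[s [n ->]]] [->|[t [m ->]]]; rewrite ?set0I ?setI0;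
    try by left.
  have [/forallP h|/forallPn[j]] :=
      boolP [forall j : 'I_(minn n m), s j == t j]; last first.
    move=> st; left; apply/seteqP; split=> // X [/= hs ht].
    have := ltn_ord j; rewrite leq_min => /andP[jn jm].
    by move: st; rewrite -hs// -ht// eqxx.
  (* Compatible cylinders intersect in the longer one. *)
  right; exists (if n <= m then t else s)%N, (maxn n m).
  have {}h j : (j < n)%N -> (j < m)%N -> s j = t j.
    move=> jn jm; have jnm : (j < minn n m)%N by rewrite leq_min jn.
    exact/eqP/(h (Ordinal jnm)).
  case: ifPn => [nm|]; [|rewrite -ltnNge => mn]; apply/seteqP; split=> X /=.
  + by move=> [_]; rewrite (maxn_idPr nm).
  + rewrite (maxn_idPr nm) => hX; split=> // j jn.
    by rewrite hX ?h//; exact: leq_trans nm.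
  + by move=> [+ _]; rewrite (maxn_idPl (ltnW mn)).
  + rewrite (maxn_idPl (ltnW mn)) => hX; split=> // j jm.
    have jn := ltn_trans jm mn.
    by rewrite hX ?h//.
- by move=> _; right; exists (fun=> false), 0%N; apply/seteqP; split.
- by rewrite bigcup_const//; exists 0%N.
- move=> B [->|[s [n ->]]]; first by rewrite !measure0.
  rewrite [RHS]coin_cylinder -(coin_cylinder R (flip i s)).
  rewrite /distribution /pushforward; congr (coin R _).
  apply/seteqP; split=> X /= h j /h; rewrite /flip; case: ifP => _ //.
    by move=> <-; rewrite negbK.
  by move=> ->; rewrite negbK.
- by move=> _; rewrite (le_lt_trans (probability_le1 _ _)) ?ltry.
Qed.

Definition pcoin (R : realType) (A : set cantor) : R := fine (coin R A).

Section Coin.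
Context (R : realType).
Local Notation mu := (pcoin R).
Implicit Types A B : set cantor.
Local Open Scope ring_scope.

Lemma coinE A : measurable A -> coin R A = (mu A)%:E.
Proof. by move=> mA; rewrite fineK// fin_num_measure. Qed.

Lemma pcoin_ge0 A : 0 <= mu A.
Proof. by rewrite fine_ge0. Qed.

Lemma pcoinDI A B : measurable A -> measurable B ->
  mu A = mu (A `\` B) + mu (A `&` B).
Proof.
move=> mA mB.
have h : (coin R A = coin R (A `\` B) + coin R (A `&` B))%E by exact: measureDI.
move: h; rewrite !coinE//; [|exact: measurableI|exact: measurableD].
by rewrite -EFinD => -[].
Qed.

Lemma le_pcoin A B : measurable A -> measurable B -> A `<=` B -> mu A <= mu B.
Proof.
move=> mA mB AB; rewrite -lee_fin -!coinE//.
by apply: le_measure; rewrite ?inE.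
Qed.

Lemma pcoinT : mu setT = 1.
Proof. by rewrite /pcoin probability_setT. Qed.

(** The flip exchanges the two halves of [A] cut out by coordinate [i] and preserves measure. *)
Lemma pcoin_half A i : measurable A -> flip i @^-1` A = A ->
  mu (A `&` [set X | X i]) = mu A / 2.
Proof.
move=> mA fA; have mi := measurable_coordinate i.
have := pcoinDI mA mi.
have -> : mu (A `\` [set X | X i]) = mu (A `&` [set X | X i]).
  have mAi : measurable (A `&` [set X : cantor | X i]) by exact: measurableI.
  rewrite /pcoin -(coin_flip R i mAi); congr (fine (coin R _)).
  apply/seteqP; split=> X /=.
    by move=> [AX /negP Xi]; split; [by rewrite -fA in AX|rewrite /flip eqxx].
  by rewrite /flip eqxx => -[AX /negP Xi]; split=> //; rewrite -fA.
by move=> ->; lra.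
Qed.

Definition block (h : nat -> nat) (k : nat) : set cantor :=
  [set X | forall j, (j < k)%N -> X (h j)].

Lemma measurable_block h k : measurable (block h k).
Proof.
rewrite (_ : block h k = \bigcap_(j in `I_k) [set X : cantor | X (h j)]).
  by apply: bigcap_measurableType => j _; exact: measurable_coordinate.
by apply/seteqP; split=> X /= hX j; exact: hX.
Qed.

(** The coordinates are added one at a time, each halving the measure: by injectivity of [h] the
    block built so far is invariant under the next flip. *)
Lemma pcoin_block A h k : injective h -> measurable A ->
  (forall j, flip (h j) @^-1` A = A) -> mu (A `&` block h k) = mu A / 2 ^+ k.
Proof.
move=> hinj mA fA; elim: k => [|k IH].
  rewrite expr0 divr1; congr mu; apply/seteqP; split=> X /=; first by case.
  by move=> AX; split=> // j.
rewrite (_ : A `&` block h k.+1 = (A `&` block h k) `&` [set X | X (h k)]).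
  rewrite pcoin_half ?IH; first by rewrite exprS; field; rewrite expf_neq0.
    by apply: measurableI => //; exact: measurable_block.
  rewrite preimage_setI fA; congr (_ `&` _).
  apply/seteqP; split=> X /= hX j jk; have := hX j jk;
    by rewrite /flip (inj_eq hinj) (ltn_eqF jk).
apply/seteqP; split=> X /=.
  by move=> [AX hX]; do !split=> //; [move=> j jk; apply/hX/ltnW|exact: hX].
move=> [[AX hX] Xk]; split=> // j; rewrite ltnS leq_eqVlt => /predU1P[->//|].
exact: hX.
Qed.

(* Events of probability 2^-(e+2), mutually independent because their blocks of
   coordinates are disjoint. *)
Definition event (w : nat) : set cantor := block (cpair w) (cfst w).+2.

Lemma measurable_event w : measurable (event w).
Proof. exact: measurable_block. Qed.

Lemma cpair_injr w : injective (cpair w).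
Proof. by move=> i j /cpair_inj[]. Qed.

Lemma pcoin_event w : mu (event w) = (2 ^+ (cfst w).+2)^-1.
Proof.
by rewrite -[event w]setTI pcoin_block ?pcoinT ?div1r//; exact: cpair_injr.
Qed.

Definition avoid (s : seq nat) : set cantor :=
  [set X | forall w, w \in s -> ~ event w X].

Lemma measurable_avoid s : measurable (avoid s).
Proof.
rewrite (_ : avoid s = \bigcap_(w in [set w | w \in s]) ~` event w)//.
apply: bigcap_measurableType => w _; apply: measurableC.
exact: measurable_event.
Qed.

(** Each new [w] contributes one factor: its block is disjoint from those of [s], so its event is
    independent of avoiding [s]. *)
Lemma pcoin_avoid e s : uniq s -> {in s, forall w, cfst w = e} ->
  mu (avoid s) = (1 - (2 ^+ e.+2)^-1) ^+ size s.
Proof.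
elim: s => [_ _|w s IH /= /andP[ws us] he].
  by rewrite expr0 -pcoinT; congr mu; apply/seteqP; split.
have {}IH : mu (avoid s) = (1 - (2 ^+ e.+2)^-1) ^+ size s.
  by apply: IH => // v vs; apply: he; rewrite inE vs orbT.
have mav := measurable_avoid s; have mw := measurable_event w.
have := pcoinDI mav mw.
rewrite pcoin_block; [|exact: cpair_injr|exact: mav|].
  rewrite he ?mem_head// (_ : avoid s `\` event w = avoid (w :: s)).
    move=> h; rewrite [size _]/= [RHS]exprS -IH mulrBl mul1r [_ * mu _]mulrC.
    by rewrite {1}h addrK.
  apply/seteqP; split=> X /=.
    by move=> [hX Xw] v; rewrite inE => /predU1P[->//|]; exact: hX.
  move=> hX; split; last by apply: hX; rewrite mem_head.
  by move=> v vs; apply: hX; rewrite inE vs orbT.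
(* A flip in the block of [w] changes no event of [s], as [w] is not in [s]. *)
move=> j; apply/seteqP; split=> X /= hX v vs;
  have vw : w == v = false by (apply/eqP => wv; rewrite wv vs in ws).
  move=> Xv; apply: (hX v vs) => k kv; rewrite /flip.
  case: eqP => [/cpair_inj[vw']|_]; last exact: Xv.
  by rewrite vw' eqxx in vw.
move=> Xv; apply: (hX v vs) => k kv; have := Xv k kv; rewrite /flip.
by case: eqP => [/cpair_inj[vw']|_]//; rewrite vw' eqxx in vw.
Qed.

(** The induction step is [(1 - q) * (1 + (n + 1) * q) <= 1 + n * q]. *)
Lemma bernoulli (q : R) n : 0 <= q <= 1 -> (1 - q) ^+ n * (1 + n%:R * q) <= 1.
Proof.
move=> /andP[q0 q1]; elim: n => [|n IH]; first by rewrite expr0; lra.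
have p0 : 0 <= (1 - q) ^+ n by rewrite exprn_ge0// subr_ge0.
have n0 : 0 <= n%:R :> R by [].
apply: le_trans IH; rewrite exprSr -mulrA ler_wpM2l//.
by rewrite -natr1; nra.
Qed.

(** If [m] elements of the section lie below [n] and [q] is [2^-(e+2)], then
    [mu P <= (1 - q)^m <= 1 / (1 + m * q)], whence [m * q <= 1 / mu P]. So any [c] above [1 / mu P]
    works for all [e]. *)
Lemma section_bound (P : set cantor) (W : nat -> bool) :
  measurable P -> 0 < mu P -> (forall X w, P X -> W w -> ~ event w X) ->
  exists c, forall e n,
    (count (fun u => W (cpair e u)) (iota 0 n) <= c * 2 ^ e.+2)%N.
Proof.
move=> mP P0 PW; have [c hc] : exists c : nat, (mu P)^-1 <= c%:R.
  by exists (Num.truncn (mu P)^-1).+1; rewrite ltW// truncnS_gt.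
exists c => e n; rewrite -size_filter; set s := [seq u <- _ | _].
have h : mu P <= (1 - (2 ^+ e.+2)^-1) ^+ size s.
  rewrite -(size_map (cpair e)) -pcoin_avoid.
  - apply: le_pcoin => //; first exact: measurable_avoid.
    move=> X PX w /mapP[u]; rewrite mem_filter => /andP[Wu _] ->.
    exact: PW.
  - by rewrite map_inj_uniq ?filter_uniq ?iota_uniq//; exact: cpair_injr.
  - by move=> _ /mapP[u _ ->]; rewrite cfst_pair.
have q0 : 0 < 2 ^+ e.+2 :> R by rewrite exprn_gt0.
have q1 : (2 ^+ e.+2)^-1 <= 1 :> R by rewrite invf_le1// exprn_ege1// ler1n.
have := @bernoulli (2 ^+ e.+2)^-1 (size s).
rewrite q1 invr_ge0 (ltW q0) => /(_ isT) hb.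
rewrite -(ler_nat R) natrM natrX -ler_pdivrMr//.
apply: le_trans hc; rewrite -[leRHS]mul1r ler_pdivlMr//.
have : mu P * (1 + (size s)%:R * (2 ^+ e.+2)^-1) <= 1.
  by apply: le_trans hb; rewrite ler_wpM2r// addr_ge0// mulr_ge0// invr_ge0.
by rewrite mulrDr mulr1 mulrC => h'; apply: le_trans h'; rewrite lerDr ltW.
Qed.

End Coin.

(** * From almost everywhere domination to a bound on refutations *)

Lemma computes_search I (O : I -> nat -> bool) (b : I -> nat -> bool) i :
  computes O (fun i n => b i n) -> (forall n, exists s, b i (cpair n s)) ->
  exists2 g, fun_turing_le g (O i) & forall n, b i (cpair n (g n)).
Proof.
move=> /computes_neg[p hp] hb.
exists (fun n => ex_minn (hb n)); last by move=> n; case: ex_minnP.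
exists (PMu p) => n; case: ex_minnP => s bs smin.
split; first by have := hp i (cpair n s); rewrite bs.
move=> k ks; exists 0; have := hp i (cpair n k).
by case: (boolP (b i _)) => // /smin; rewrite leqNgt ks.
Qed.

Definition eventb (X : nat -> bool) (w : nat) : bool :=
  all (fun j => X (cpair w j)) (iota 0 (cfst w).+2).

Lemma eventbP X w : reflect (event w X) (eventb X w).
Proof.
apply: (iffP allP) => h j; first by move=> jw; apply: h; rewrite mem_iota.
by rewrite mem_iota => /andP[_]; exact: h.
Qed.

Lemma computes_eventb : computes id (fun X w => eventb X w).
Proof.
have h : computes id (fun X w =>
    count (fun j => X (cpair w j)) (iota 0 (cfst w).+2)).
  apply: (@computes_count _ _ (fun X w j => X (cpair w j)));
    last by computes_tac.
  apply: (@computes_oracle _ id (fun _ w => cpair (cfst w) (csnd w))).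
  by computes_tac.
have h' : computes id (fun X w =>
  count (fun j => X (cpair w j)) (iota 0 (cfst w).+2) == (cfst w).+2).
  by computes_tac.
by apply: computes_ext h' => X w; rewrite /eventb all_count size_iota.
Qed.

(* The events at unrefuted indices have total probability at most 1/2, and on
   the complement a search for refutations at the indices of the occurring
   events always terminates; f bounds this search on a set of positive
   measure. *)
Lemma ae_dominating_bound (R : realType) (Z : nat -> bool) :
  ae_dominating R Z ->
  exists2 f, fun_turing_le f Z & exists2 P : set cantor,
    measurable P /\ (0 < pcoin R P)%R &
    forall X w, P X -> ~~ refuted w (f w) -> ~ event w X.
Proof.
pose P (f : nat -> nat) : set cantor :=
  [set X | forall w, ~~ refuted w (f w) -> ~ event w X].
have mP f : measurable (P f).
  rewrite (_ : P f = \bigcap_(w in [set w | ~~ refuted w (f w)]) ~` event w)//.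
  apply: bigcap_measurableType => w _; apply: measurableC.
  exact: measurable_event.
move=> ae; apply: contrapT => none.
have null f : fun_turing_le f Z -> coin R (P f) = 0%E.
  move=> fZ; rewrite coinE//; congr EFin; apply/eqP.
  rewrite eq_le pcoin_ge0 andbT leNgt; apply/negP => P0.
  by apply: none; exists f => //; exists (P f) => // X w; exact.
(* Here [k] pairs the code of a program for [f] with a constant. Taking the maximum with the
   constant repairs the finitely many places where domination fails, and makes the union over all
   [f] countable. *)
pose F k : set cantor := [set X | exists p f,
  [/\ encode p = cfst k, forall n, eval Z p n (f n)
    & P (fun n => maxn (f n) (csnd k)) X]].
have negF k : (coin R).-negligible (F k).
  have [[p [f [pk hf]]]|nopf] := pselect (exists p f,
      encode p = cfst k /\ forall n, eval Z p n (f n)); last first.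
    rewrite (_ : F k = set0); first exact: negligible_set0.
    apply/seteqP; split=> // X [p [f [pk hf _]]].
    by apply: nopf; exists p, f.
  exists (P (fun n => maxn (f n) (csnd k))); split=> //.
    apply: null; apply/fun_turing_leE.
    have hf' : computes (fun _ : unit => Z) (fun _ => f) by exists p.
    by rewrite /maxn; computes_tac.
  move=> X [p' [f' [pk' hf' PX]]].
  have pp : p = p' by apply: encode_inj; rewrite pk.
  rewrite (_ : f = f')//; apply/funext => n.
  by apply: eval_functional (hf n) _; rewrite pp.
pose H e : set cantor :=
  [set X | exists2 u, unrefuted (cpair e u) & event (cpair e u) X].
have HE e : H e = set0 \/
    exists2 u, unrefuted (cpair e u) & H e = event (cpair e u).
  have [[u hu]|nou] := pselect (exists u, unrefuted (cpair e u)); [right|left].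
    exists u => //; apply/seteqP; split=> X; last by exists u.
    by move=> [v hv]; rewrite (unrefuted_unique hv hu).
  by apply/seteqP; split=> // X [u hu _]; apply: nou; exists u.
have mH e : measurable (H e).
  by have [->|[u _ ->]] := HE e; [exact: measurable0|exact: measurable_event].
(* The bound [2^-(e+2)] is written in the shape whose sum over [e] is [1/2]. *)
have muH e : (coin R (H e) <= ((2^-1 : R) / (2 ^ e.+1)%:R)%:E)%E.
  have [->|[u _ ->]] := HE e; first by rewrite measure0 lee_fin divr_ge0.
  rewrite coinE; last exact: measurable_event.
  by rewrite pcoin_event cfst_pair lee_fin natrX [(2 ^+ e.+2)%R]exprS invfM.
have muHU : (coin R (\bigcup_e H e) <= (2^-1 : R)%:E)%E.
  apply: (@le_trans _ _ (\sum_(e <oo) coin R (H e))%E).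
    by apply: generalized_Boole_inequality => //; exact: bigcupT_measurable.
  apply: le_trans (epsilon_trick0 xpredT _); last by rewrite invr_ge0.
  by apply: lee_nneseries.
have [N [mN N0 NS]] := negligibleU ae (negligible_bigcup negF).
(* For [X] outside every [H e], each occurring event has a refutable index, so [X] computes a bound
   [g] on refutation stages. If moreover some [f] computable from [Z] dominates [g], then [X] lies
   in some [F k]. *)
have cover : [set: cantor] `<=` N `|` \bigcup_e H e.
  move=> X _; apply: contrapT => /not_orP[XN XH]; apply: XN; apply: NS.
  apply: contrapT => /not_orP[/contrapT Xdom XF]; apply: XF.
  pose b (Y : nat -> bool) w :=
    ~~ eventb Y (cfst w) || refuted (cfst w) (csnd w).
  have hb : computes id (fun Y w => b Y w).
    rewrite /b; have he := computes_eventb.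
    have he' : computes id (fun Y w => eventb Y (cfst w)).
      exact: (computes_comp he (computes_fst (computes_id _))).
    have hr := computes_refuted (id : (nat -> bool) -> _).
    by computes_tac.
  have [n|g gX gb] := @computes_search _ id b X hb.
    rewrite /b; apply: contrapT => hn; apply: XH; exists (cfst n) => //.
    exists (csnd n); rewrite cpair_eta.
      move=> s; apply/negP => r; apply: hn; exists s.
      by rewrite !cpairE r orbT.
    apply/eventbP; apply: contrapT => /negP r; apply: hn; exists 0%N.
    by rewrite !cpairE r.
  have [f [p hf] [m hm]] := Xdom g gX.
  exists (cpair (encode p) (\max_(n < m.+1) g n)%N) => //.
  exists p, f; split=> //; rewrite !cpairE // => w nr /eventbP ev.
  have := gb w; rewrite /b !cpairE ev /= => r; move/negP: nr; apply.
  apply: refuted_mono r; rewrite leq_max; apply/orP.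
  have [wm|mw] := leqP w m; last by left; exact/ltnW/hm.
  right; exact: (leq_bigmax (Ordinal (n:=m.+1) wm)).
have mHU : measurable (\bigcup_e H e) by exact: bigcupT_measurable.
(* The whole space would have measure at most [0 + 1/2]. *)
have h : (1 <= coin R (N `|` \bigcup_e H e))%E.
  rewrite -(probability_setT (coin R)); apply: le_measure => //; rewrite inE//.
  exact: measurableU.
have h2 : (1 <= coin R N + coin R (\bigcup_e H e))%E.
  exact: le_trans h (measureU2 _ mN mHU).
have := le_trans h2 (leeD2l (coin R N) muHU).
have -> : coin R N = 0%E by [].
by rewrite add0e lee_fin; lra.
Qed.

Lemma corollary5p9 (R : realType) (Z : nat -> bool) :
  turing_le Z (jump emptyset) -> ae_dominating R Z ->
  tt_equiv (jump Z) (jump (jump emptyset)) /\ superhigh Z.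
Proof.
move=> Z0 aeZ.
(* One reduction needs only that [Z] is computable from the halting problem; the other is
   superhighness itself. *)
suff sh : superhigh Z by split=> //; split=> //; exact: jump_tt_le_of_turing_le.
have [f fZ [P [mP P0] Pf]] := ae_dominating_bound aeZ.
(* An index is in [W] when it is not refuted by stage [f w]. This is decidable from [Z] and keeps
   every unrefuted index. *)
have [c hc] := section_bound (W := fun w => ~~ refuted w (f w)) mP P0 Pf.
apply: (jump_jump_tt_le_of_trace (W := fun w => ~~ refuted w (f w)) _ hc) => //.
apply/fun_turing_leE; move/fun_turing_leE: fZ => hf.
have h : computes (fun _ : unit => Z) (fun _ w => refuted w (f w)).
  have := computes_comp (computes_refuted (fun _ : unit => Z))
    (computes_pair (computes_id _) hf).
  by apply: computes_ext => i w; rewrite !cpairE.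
exact: (computes_neg h).
Qed.
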